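(* Let $Z\subseteq\{0,1\}^N$, let $r\le k\le n$ be positive integers, and let $f=\bigvee_A f_A$, where $A$ ranges over the $k$-subsets of $[n]$ and the $f_A:Z\to\{0,1\}$ are Boolean functions. For every subset $S\subseteq[N]$, let $\mathsf{Load}_S$ be a super edge loading $S$ with $c^1(\mathsf{Load}_S)\le 1$. Let $I$ be a monotone mapping from subsets of $[n]$ to subsets of $[N]$ (i.e. $A'\subseteq A''$ implies $I(A')\subseteq I(A'')$) with the property that for every $y\in f^{-1}(1)$ there is an $r$-subset $T_y\subseteq[n]$ whose image $I(T_y)$ is a $1$-certificate for $y$. Let $\mathbf S,\mathbf U>0$ be such that every $x\in f^{-1}(0)$ satisfies $$\mathop{\mathrm{Exp}}_{A'\subset[n]:\,|A'|=k-r}\left(c^0(\mathsf{Load}_{I(A')},x)\right)\le \mathbf S^2,$$ $$\mathop{\mathrm{Exp}}_{A'\subset A''\subseteq[n]:\,|A'|=|A''|-1=i}\left(c^0(\mathsf{Load}_{I(A'')\setminus I(A')},x)\right)\le\mathbf U^2\quad\text{for } k-r\le i<k.$$ For every $k$-subset $A$ of $[n]$ and every possible assignment $\lambda$ over $I(A)$, let $\mathcal G_{A,\lambda}$ be an extended learning graph for the function $f_A$ restricted to the inputs $Z_\lambda=\{z\in Z: z_{I(A)}=\lambda\}$. Let $\mathbf C>0$ be such that every $x\in f^{-1}(0)$ satisfies $$\mathop{\mathrm{Exp}}_{A\subseteq[n]:\,|A|=k}\left(C^0(\mathcal G_{A,x_{I(A)}},x)\,C^1(\mathcal G_{A,x_{I(A)}})\right)\le\mathbf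 C^2.$$ Then there is an extended learning graph $\mathcal G_{\mathrm{Johnson}}$ for $f$ such that for every $z\in Z$: $$C^0(\mathcal G_{\mathrm{Johnson}},z)=O\left(\mathbf S^2+\left(\frac nk\right)^r\left(k\,\mathbf U^2+\mathbf C^2\right)\right)\ \text{ when } f(z)=0,\qquad C^1(\mathcal G_{\mathrm{Johnson}},z)\le1\ \text{ when } f(z)=1,$$ where the constant hidden in $O(\cdot)$ depends only on $r$. All expectations are over the uniform distribution on the indicated sets.
   Context: For $S\subseteq[N]$, $z_S$ is the restriction of $z$ to the positions in $S$. A $1$-certificate for $y\in f^{-1}(1)$ (with respect to $f$) is a set $J\subseteq[N]$ such that $f(z)=1$ for every $z\in Z$ with $z_J=y_J$. Extended learning graph. Let $Y\subseteq Z\subseteq\{0,1\}^N$. An extended learning graph $\mathcal G$ is a $5$-tuple $(\mathcal V,\mathcal E,\mathcal S,\{w_z^b: z\in Z,b\in\{0,1\}\},\{p_y:y\in Y\})$ such that: (i) $(\mathcal V,\mathcal E)$ is a (finite) directed acyclic graph rooted at some vertex; (ii) $\mathcal S$ maps each $v\in\mathcal V$ to $\mathcal S(v)\subseteq[N]$, the root is labelled $\emptyset$ and, for every $(u,v)\in\mathcal E$, $\mathcal S(v)=\mathcal S(u)\cup\{j\}$ for some $j\notin\mathcal S(u)$; (iii) for every $(u,v)\in\mathcal E$, the weights $w_z^b(u,v)$ are in $\mathbb R_{\ge0}$ and depend on $z$ only through $z_{\mathcal S(v)}$; (iv) $w_x^0(u,v)=w_y^1(u,v)$ for all $x\in Z\setminus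 Y$, $y\in Y$ and $(u,v)\in\mathcal E$ with $\mathcal S(v)=\mathcal S(u)\cup\{j\}$, $x_{\mathcal S(u)}=y_{\mathcal S(u)}$ and $x_j\ne y_j$; (v) for every $y\in Y$, $p_y:\mathcal E\to\mathbb R_{\ge0}$ is a unit flow whose source is the root, with $p_y(e)=0$ whenever $w_y^1(e)=0$. $\mathcal G$ is an extended learning graph for a function $g:Z\to\{0,1\}$ if $Y=g^{-1}(1)$ and, for every $y\in Y$, the label of each sink of $p_y$ contains a $1$-certificate for $g$ on $y$. Complexity. For $x\in Z\setminus Y$ and $y\in Y$: $C^0(\mathcal G,x)=\sum_{e\in\mathcal E}w_x^0(e)$, $C^1(\mathcal G,y)=\sum_{e\in\mathcal E}p_y(e)^2/w_y^1(e)$ (terms with $p_y(e)=0$ count as $0$), $C^1(\mathcal G)=\max_{y\in Y}C^1(\mathcal G,y)$ (a maximum over the empty set is $0$). For $\mathcal G_{A,\lambda}$ the input set is $Z_\lambda$ and the positive inputs are those $y\in Z_\lambda$ with $f_A(y)=1$. Super edge. A super edge $e$ loading $S\subseteq[N]$ is an extended learning graph $\mathcal G_e$ (here with input set $Z$ and positive inputs $Y=f^{-1}(1)$) such that all its flows $p_y$ have the same unique sink, labelled by $S$ (for $S=\emptyset$ it may be reduced to its root). Its edge-complexities are $c^0(e,x)=C^0(\mathcal G_e,x)$ for $x\in Z\setminus Y$, $c^1(e,y)=C^1(\mathcal G_e,y)$ for $y\in Y$, and $c^1(e)=\max_{y\in Y}c^1(e,y)$. *)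

(* Defs.v *)
From HB Require Import structures.
From mathcomp Require Import all_boot all_order all_algebra.
From mathcomp Require Import reals.

Set Implicit Arguments.
Unset Strict Implicit.
Unset Printing Implicit Defensive.

Import Order.TTheory GRing.Theory Num.Theory.
Local Open Scope ring_scope.

Definition point (N : nat) : finType := {ffun 'I_N -> bool}.

Definition assignment (N : nat) (S : {set 'I_N}) : finType :=
  {ffun {j : 'I_N | j \in S} -> bool}.

Definition restr (N : nat) (S : {set 'I_N}) (z : point N) : assignment S :=
  [ffun j => z (val j)].

(* A function on Z is given by a function on the whole cube, of which only the
   values on Z are ever used. *)
Definition positives (N : nat) (Z : {set point N}) (g : point N -> bool) :
  {set point N} := [set z in Z | g z].

Definition certificate1 (N : nat) (Z : {set point N}) (g : point N -> bool)
    (y : point N) (J : {set 'I_N}) : Prop :=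
  forall z, z \in Z -> restr J z = restr J y -> g z.

(* The values of weight and flow outside the edges, of weight outside the input
   set and of flow outside the positive inputs are irrelevant: neither the
   axioms nor the complexities below refer to them. *)
Record xlgraph (R : realType) (N : nat) := XLGraph {
  vertex : finType;
  edge : rel vertex;
  root : vertex;
  label : vertex -> {set 'I_N};
  weight : bool -> point N -> vertex -> vertex -> R;
  flow : point N -> vertex -> vertex -> R
}.

Arguments edge {R N} G : rename.
Arguments root {R N} G : rename.
Arguments label {R N} G v : rename.
Arguments weight {R N} G b z u v : rename.
Arguments flow {R N} G y u v : rename.

(* The amount absorbed at v when one unit is injected at the root. A unit flow
   has nonnegative excess everywhere, and its sinks are the vertices with
   positive excess. The root itself may be a sink: this covers the zero flow on
   a graph reduced to its root. *)
Definition excess (R : realType) (N : nat) (G : xlgraph R N)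
    (p : vertex G -> vertex G -> R) (v : vertex G) : R :=
  (v == root G)%:R + \sum_(u | edge G u v) p u v - \sum_(u | edge G v u) p v u.

Definition unit_flow (R : realType) (N : nat) (G : xlgraph R N)
    (p : vertex G -> vertex G -> R) : Prop :=
  (forall u v, edge G u v -> 0 <= p u v) /\ (forall v, 0 <= excess p v).

Definition is_sink (R : realType) (N : nat) (G : xlgraph R N)
    (p : vertex G -> vertex G -> R) (v : vertex G) : Prop :=
  0 < excess p v.

Record is_xlgraph (R : realType) (N : nat) (Z Y : {set point N})
    (G : xlgraph R N) : Prop := IsXLGraph {
  xlg_subset : Y \subset Z;
  xlg_acyclic : forall u s, path (edge G) u s -> last u s = u -> s = [::];
  xlg_rooted : forall v, connect (edge G) (root G) v;
  xlg_label_root : label G (root G) = set0;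
  xlg_label_edge : forall u v, edge G u v ->
    exists2 j, j \notin label G u & label G v = label G u :|: [set j];
  xlg_weight_ge0 : forall b z u v, z \in Z -> edge G u v ->
    0 <= weight G b z u v;
  xlg_weight_restr : forall b z z' u v, z \in Z -> z' \in Z -> edge G u v ->
    restr (label G v) z = restr (label G v) z' ->
    weight G b z u v = weight G b z' u v;
  xlg_weight01 : forall x y u v j, x \in Z :\: Y -> y \in Y -> edge G u v ->
    label G v = label G u :|: [set j] ->
    restr (label G u) x = restr (label G u) y -> x j <> y j ->
    weight G false x u v = weight G true y u v;
  xlg_unit_flow : forall y, y \in Y -> unit_flow (flow G y);
  xlg_flow_weight : forall y u v, y \in Y -> edge G u v ->
    weight G true y u v = 0 -> flow G y u v = 0
}.

Definition xlgraph_for (R : realType) (N : nat) (Z : {set point N})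
    (g : point N -> bool) (G : xlgraph R N) : Prop :=
  is_xlgraph Z (positives Z g) G /\
  (forall y v, y \in positives Z g -> is_sink (flow G y) v ->
     exists2 J : {set 'I_N}, J \subset label G v & certificate1 Z g y J).

Definition compl0 (R : realType) (N : nat) (G : xlgraph R N) (x : point N) : R :=
  \sum_(e : vertex G * vertex G | edge G e.1 e.2) weight G false x e.1 e.2.

(* Since 0 / 0 = 0, the terms with zero flow vanish. *)
Definition compl1 (R : realType) (N : nat) (G : xlgraph R N) (y : point N) : R :=
  \sum_(e : vertex G * vertex G | edge G e.1 e.2)
    flow G y e.1 e.2 ^+ 2 / weight G true y e.1 e.2.

Definition max_compl1 (R : realType) (N : nat) (Y : {set point N})
    (G : xlgraph R N) : R :=
  \big[Num.max/0]_(y in Y) compl1 G y.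

Definition super_edge (R : realType) (N : nat) (Z Y : {set point N})
    (S : {set 'I_N}) (G : xlgraph R N) : Prop :=
  is_xlgraph Z Y G /\
  (exists2 t, label G t = S &
     forall y v, y \in Y -> (is_sink (flow G y) v <-> v = t)).

Definition expectation (R : realType) (T : finType) (D : {set T})
    (F : T -> R) : R :=
  (\sum_(t in D) F t) / #|D|%:R.

Definition ksubsets (n k : nat) : {set {set 'I_n}} :=
  [set A : {set 'I_n} | #|A| == k].

Definition kpairs (n i : nat) : {set {set 'I_n} * {set 'I_n}} :=
  [set P : {set 'I_n} * {set 'I_n} |
    [&& P.1 \subset P.2, #|P.1| == i & #|P.2| == i.+1]].

Definition fiber (N : nat) (Z : {set point N}) (S : {set 'I_N})
    (lam : assignment S) : {set point N} :=
  [set z in Z | restr S z == lam].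

(* Main.v *)
(* Since the I(T_y) are certificates for f itself, it suffices to load I(A) for
   some A containing T_y. The flow of y chooses a (k-r)-subset A' uniformly,
   loads I(A'), and then adds the missing elements of T_y one at a time, stopping
   as soon as T_y is included; stopping early is what makes the bound hold also
   when k is close to n. With M = C(n, k-r), a transition carries at most 2^r / M
   units of flow, because A' is recovered from the current set by removing a subset
   of T_y. As the flows through all pieces sum to at most r+1, giving every piece
   the same coefficient (r+1) 2^r / M bounds C^1 by 1, and C^0 then follows from
   |{(A', A'') : |A'| = i}| <= r^r k (n/k)^r M for k-r <= i < k.

   Identifying the vertices with equal labels, and adding up weights and flows of
   the edges that become parallel, preserves C^0 and, by Cauchy-Schwarz, does not
   increase C^1. Hence the graph can be built on the vertices of the hypercube of
   subsets of [N], where it is acyclic and rooted whatever the pieces are. *)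
Require Import Defs.
From HB Require Import structures.
From mathcomp Require Import all_boot all_order all_algebra.
From mathcomp Require Import reals ring lra.

Set Implicit Arguments.
Unset Strict Implicit.
Unset Printing Implicit Defensive.

Import Order.TTheory GRing.Theory Num.Theory.
Local Open Scope ring_scope.

(** * Restrictions, and a Cauchy-Schwarz inequality *)

Lemma restr_eqP (N : nat) (S : {set 'I_N}) (z z' : point N) :
  restr S z = restr S z' <-> {in S, z =1 z'}.
Proof.
split=> [/ffunP zz' j jS | zz'].
  by have := zz' (Sub j jS); rewrite !ffunE.
by apply/ffunP => j; rewrite !ffunE; apply: zz'; apply: valP.
Qed.

Lemma restr_subset (N : nat) (S S' : {set 'I_N}) (z z' : point N) :
  S \subset S' -> restr S' z = restr S' z' -> restr S z = restr S z'.
Proof.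
by move=> /subsetP SS' /restr_eqP zz'; apply/restr_eqP => j /SS'; apply: zz'.
Qed.

Lemma sqr_div_addr (R : realFieldType) (a b u v : R) :
  0 <= u -> 0 <= v -> (u = 0 -> a = 0) -> (v = 0 -> b = 0) ->
  (a + b) ^+ 2 / (u + v) <= a ^+ 2 / u + b ^+ 2 / v.
Proof.
move=> u0 v0 ua vb.
have [/eqP uz|un] := boolP (u == 0).
  by rewrite (ua uz) uz !add0r expr0n mul0r add0r.
have [/eqP vz|vn] := boolP (v == 0).
  by rewrite (vb vz) vz !addr0 expr0n mul0r addr0.
have {}u0 : 0 < u by rewrite lt0r un.
have {}v0 : 0 < v by rewrite lt0r vn.
have uv0 := addr_gt0 u0 v0.
rewrite -subr_ge0.
have -> : a ^+ 2 / u + b ^+ 2 / v - (a + b) ^+ 2 / (u + v)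
          = (a * v - b * u) ^+ 2 / (u * v * (u + v)).
  by field; rewrite un vn gt_eqF.
by apply: divr_ge0; rewrite ?sqr_ge0 // !mulr_ge0 // ltW.
Qed.

(** Cauchy-Schwarz in quotient form, for edges that become parallel. The induction also carries
    nonnegativity and the implication between zeros, which the two-term case requires. *)
Lemma sqr_sum_div (R : realFieldType) (T : finType) (P : pred T) (p w : T -> R) :
  (forall t, P t -> 0 <= w t) -> (forall t, P t -> w t = 0 -> p t = 0) ->
  (\sum_(t | P t) p t) ^+ 2 / (\sum_(t | P t) w t)
    <= \sum_(t | P t) p t ^+ 2 / w t.
Proof.
move=> w0 wp.
pose K (x y s : R) := [/\ 0 <= y, y = 0 -> x = 0 & x ^+ 2 / y <= s].
suff [] : K (\sum_(t | P t) p t) (\sum_(t | P t) w t)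
            (\sum_(t | P t) p t ^+ 2 / w t) by [].
apply: (big_rec3 K); first by split; rewrite // expr0n mul0r.
move=> t x y s Pt [y0 yx xy]; split.
- by rewrite addr_ge0 ?w0.
- move=> /eqP; rewrite paddr_eq0 ?w0 // => /andP[/eqP wt /eqP yt].
  by rewrite wp // yx // addr0.
- apply: le_trans (lerD (lexx _) xy).
  by apply: sqr_div_addr; rewrite ?w0 //; exact: wp.
Qed.

(** * Identifying vertices with equal labels, on the hypercube *)

Definition hcube_edge (N : nat) : rel {set 'I_N} :=
  fun U V => [exists j, (j \notin U) && (V == U :|: [set j])].

Lemma hcube_edgeP (N : nat) (U V : {set 'I_N}) :
  reflect (exists2 j, j \notin U & V = U :|: [set j]) (hcube_edge U V).
Proof.
by apply: (iffP existsP) => [[j /andP[jU /eqP ->]] | [j jU ->]]; exists j => //;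
  rewrite jU eqxx.
Qed.

(** Each edge adds one element. Hence a closed path has length zero, which is acyclicity. *)
Lemma hcube_edge_path_card (N : nat) (U : {set 'I_N}) s :
  path (@hcube_edge N) U s -> #|last U s| = (#|U| + size s)%N.
Proof.
elim: s U => [|V s IHs] U /=; first by rewrite addn0.
case/andP => /hcube_edgeP[j jU ->] /IHs ->.
by rewrite setUC cardsU1 jU addnS.
Qed.

Lemma hcube_edge_connect (N : nat) (V : {set 'I_N}) :
  connect (@hcube_edge N) set0 V.
Proof.
have [m] := ubnP #|V|; elim: m V => // m IHm V.
have [-> //|/set0Pn[j jV]] := eqVneq V set0.
rewrite (cardsD1 j) jV => /IHm {}IHm.
apply: connect_trans IHm (connect1 _).
by apply/hcube_edgeP; exists j; rewrite ?setD11 // setUC setD1K.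
Qed.

(** An index [t] in [D] stands for an edge before identification, with end labels [s t] and [d t].
    Hypercube edges that receive no index get weight and flow zero. *)
Definition collapse (R : realType) (N : nat) (T : finType) (D : pred T)
    (s d : T -> {set 'I_N}) (w : bool -> point N -> T -> R)
    (p : point N -> T -> R) : xlgraph R N :=
  @XLGraph R N {set 'I_N} (@hcube_edge N) set0 id
    (fun b z U V => \sum_(t | [&& D t, s t == U & d t == V]) w b z t)
    (fun y U V => \sum_(t | [&& D t, s t == U & d t == V]) p y t).

Lemma collapse_sum (R : realType) (N : nat) (T : finType) (D : pred T)
    (s d : T -> {set 'I_N}) (F : T -> R) :
  (forall t, D t -> hcube_edge (s t) (d t)) ->
  \sum_(e | hcube_edge e.1 e.2) \sum_(t | [&& D t, s t == e.1 & d t == e.2]) F t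
    = \sum_(t | D t) F t.
Proof.
move=> Dsd; rewrite [RHS](partition_big (fun t => (s t, d t))
  (fun e => hcube_edge e.1 e.2)) //=.
Qed.

Lemma collapse_excess (R : realType) (N : nat) (T : finType) (D : pred T)
    (s d : T -> {set 'I_N}) (w : bool -> point N -> T -> R)
    (p : point N -> T -> R) (y : point N) (V : {set 'I_N}) :
  (forall t, D t -> hcube_edge (s t) (d t)) ->
  excess (flow (collapse D s d w p) y) V =
    (V == set0)%:R + \sum_(t | D t && (d t == V)) p y t
                   - \sum_(t | D t && (s t == V)) p y t.
Proof.
move=> Dsd; rewrite /excess /=; congr (_ + _ - _).
- rewrite [RHS](partition_big s (fun U => hcube_edge U V)) /=.
    apply: eq_bigr => U _; apply: eq_bigl => t.
    by rewrite -andbA; congr (_ && _); rewrite andbC.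
  by move=> t /andP[/Dsd ? /eqP <-].
- rewrite [RHS](partition_big d (fun U => hcube_edge V U)) /=.
    by apply: eq_bigr => U _; apply: eq_bigl => t; rewrite andbA.
  by move=> t /andP[/Dsd ? /eqP <-].
Qed.

Lemma collapse_xlgraph (R : realType) (N : nat) (Z Y : {set point N})
    (T : finType) (D : pred T)
    (s d : T -> {set 'I_N}) (w : bool -> point N -> T -> R)
    (p : point N -> T -> R) :
  Y \subset Z ->
  (forall t, D t -> hcube_edge (s t) (d t)) ->
  (forall b z t, z \in Z -> D t -> 0 <= w b z t) ->
  (forall b z z' t, z \in Z -> z' \in Z -> D t ->
     restr (d t) z = restr (d t) z' -> w b z t = w b z' t) ->
  (forall x y t j, x \in Z :\: Y -> y \in Y -> D t -> d t = s t :|: [set j] ->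
     restr (s t) x = restr (s t) y -> x j <> y j ->
     w false x t = w true y t) ->
  (forall y t, y \in Y -> D t -> 0 <= p y t) ->
  (forall y V, y \in Y -> 0 <= excess (flow (collapse D s d w p) y) V) ->
  (forall y t, y \in Y -> D t -> w true y t = 0 -> p y t = 0) ->
  is_xlgraph Z Y (collapse D s d w p).
Proof.
move=> YZ Dsd w0 wr w01 p0 pex wp; split => //=.
- move=> U c /hcube_edge_path_card + cU; rewrite cU => /eqP.
  by rewrite -{1}[#|U|]addn0 eqn_add2l eq_sym size_eq0 => /eqP.
- exact: hcube_edge_connect.
- by move=> U V /hcube_edgeP.
- by move=> b z U V zZ _; apply: sumr_ge0 => t /and3P[Dt _ _]; apply: w0.
- move=> b z z' U V zZ z'Z _ zz'; apply: eq_bigr => t /and3P[Dt _ /eqP dt].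
  by apply: wr; rewrite // dt.
- move=> x y U V j xZ yY _ VU xy xyj.
  apply: eq_bigr => t /and3P[Dt /eqP st /eqP dt].
  by apply: (w01 _ _ _ j); rewrite // ?st ?dt.
- move=> y yY; split=> [U V _|V]; last exact: pex.
  by apply: sumr_ge0 => t /and3P[Dt _ _]; apply: p0.
(* A sum of nonnegative weights vanishes only termwise, and then each merged flow vanishes too. *)
- move=> y U V yY _ /psumr_eq0P ws; apply: big1 => t Pt.
  have /and3P[Dt _ _] := Pt; apply: wp => //; apply: ws => // t' /and3P[Dt' _ _].
  by apply: w0 => //; exact: (subsetP YZ).
Qed.

Lemma collapse_compl0 (R : realType) (N : nat) (T : finType) (D : pred T)
    (s d : T -> {set 'I_N}) (w : bool -> point N -> T -> R)
    (p : point N -> T -> R) (x : point N) :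
  (forall t, D t -> hcube_edge (s t) (d t)) ->
  compl0 (collapse D s d w p) x = \sum_(t | D t) w false x t.
Proof. by move=> Dsd; rewrite -[RHS](@collapse_sum _ _ _ _ s d _ Dsd). Qed.

Lemma collapse_compl1 (R : realType) (N : nat) (T : finType) (D : pred T)
    (s d : T -> {set 'I_N}) (w : bool -> point N -> T -> R)
    (p : point N -> T -> R) (y : point N) :
  (forall t, D t -> hcube_edge (s t) (d t)) ->
  (forall t, D t -> 0 <= w true y t) ->
  (forall t, D t -> w true y t = 0 -> p y t = 0) ->
  compl1 (collapse D s d w p) y <= \sum_(t | D t) p y t ^+ 2 / w true y t.
Proof.
move=> Dsd w0 wp; rewrite -[leRHS](@collapse_sum _ _ _ _ s d _ Dsd).
by apply: ler_sum => e _; apply: sqr_sum_div => t /and3P[Dt _ _]; auto.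
Qed.

(** * Flow through one super edge *)

Lemma sum_pred1 (R : pzSemiRingType) (T : finType) (Q : pred T) (t : T) :
  \sum_(v | Q v) (v == t)%:R = (Q t)%:R :> R.
Proof.
under eq_bigr do rewrite mulrb.
rewrite -big_mkcondr mulrb; case: ifP => [Qt | nQt].
  by rewrite (big_pred1 t) // => v /=; case: eqP => [->|]; rewrite ?Qt ?andbF.
by rewrite big1 // => v /andP[Qv /eqP vt]; rewrite -vt Qv in nQt.
Qed.

(** Edges with both ends in [Q] cancel. For [predT] this says that the total excess is 1. *)
Lemma sum_excess (R : realType) (N : nat) (L : xlgraph R N)
    (p : vertex L -> vertex L -> R) (Q : pred (vertex L)) :
  \sum_(v | Q v) excess p v =
    (Q (Defs.root L))%:R
    + \sum_(e : vertex L * vertex L | edge L e.1 e.2 && Q e.2) p e.1 e.2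
    - \sum_(e : vertex L * vertex L | edge L e.1 e.2 && Q e.1) p e.1 e.2.
Proof.
rewrite /excess sumrB big_split /=; congr (_ + _ - _).
- exact: sum_pred1.
- rewrite (exchange_big_dep predT) //= pair_big_dep /=.
  by apply: eq_bigl => e; rewrite andbC.
- by rewrite pair_big_dep /=; apply: eq_bigl => e; rewrite andbC.
Qed.

(** Excess is nonnegative, vanishes off the sink and sums to 1, so the sink absorbs the whole
    unit. *)
Lemma super_edge_excess (R : realType) (N : nat) (Z Y : {set point N})
    (S : {set 'I_N}) (L : xlgraph R N) :
  super_edge Z Y S L ->
  exists2 t, label L t = S &
    forall y v, y \in Y -> excess (flow L y) v = (v == t)%:R.
Proof.
case=> LG [t tS sinkt]; exists t => // y v yY.
have [p0 ex0] := xlg_unit_flow LG yY.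
have exN u : u != t -> excess (flow L y) u = 0.
  move=> /eqP ut; apply/eqP; have := ex0 u; rewrite le0r => /orP[//|].
  by move/(sinkt _ _ yY).
have [->|/exN //] := eqVneq v t.
have := sum_excess (flow L y) predT.
rewrite (bigD1 t) //= big1 ?addr0; last by move=> u; apply: exN.
by rewrite addrK.
Qed.

(* Labels grow along edges, so a unit of flow that has entered a label not
   contained in S can never reach the unique sink. *)
Lemma super_edge_flow0 (R : realType) (N : nat) (Z Y : {set point N})
    (S : {set 'I_N}) (L : xlgraph R N) (y : point N) (u v : vertex L) :
  super_edge Z Y S L -> y \in Y -> edge L u v -> ~~ (label L v \subset S) ->
  flow L y u v = 0.
Proof.
move=> LS yY; have [t tS exL] := super_edge_excess LS.
case: LS => LG _; have [p0 _] := xlg_unit_flow LG yY.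
(* Induction from large labels down: the outflow of [v] is zero, and [v] is neither root nor sink,
   so its nonnegative inflows sum to zero. *)
have [m] := ubnP (N - #|label L v|)%N; elim: m u v => // m IHm u v Nv uv vS.
have vt : v != t by apply: contraNneq vS => ->; rewrite tS.
have vr : v != Defs.root L.
  by apply: contraNneq vS => ->; rewrite (xlg_label_root LG) sub0set.
have := exL _ v yY.
rewrite /excess (negbTE vr) (negbTE vt) add0r [X in _ - X]big1.
  rewrite subr0 => /eqP; rewrite psumr_eq0; last by move=> w; apply: p0.
  by move=> /allP /(_ u); rewrite mem_index_enum uv => /(_ isT) /eqP.
move=> w vw; have [j jv lw] := xlg_label_edge LG vw.
apply: IHm => //; last first.
  by apply: contraNN vS; apply: subset_trans; rewrite lw subsetUl.
have lwN : (#|label L w| <= N)%N by rewrite -[X in (_ <= X)%N]card_ord max_card.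
move: Nv lwN; rewrite lw setUC cardsU1 jv add1n => Nv lwN.
by apply: leq_trans (_ : N - #|label L v| <= m)%N => //; rewrite ltn_sub2l.
Qed.

(** With [B] added to every label, the super edge acts as a single edge moving one unit from [B] to
    [B :|: S]. Edges leaving [S] may be discarded because they carry no flow. *)
Lemma super_edge_transport (R : realType) (N : nat) (Z Y : {set point N})
    (S B V : {set 'I_N}) (L : xlgraph R N) (y : point N) :
  super_edge Z Y S L -> y \in Y ->
  \sum_(e : vertex L * vertex L |
      [&& edge L e.1 e.2, label L e.2 \subset S & B :|: label L e.2 == V])
      flow L y e.1 e.2
  - \sum_(e : vertex L * vertex L |
      [&& edge L e.1 e.2, label L e.2 \subset S & B :|: label L e.1 == V])
      flow L y e.1 e.2
  = (B :|: S == V)%:R - (B == V)%:R.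
Proof.
move=> LS yY; have [t tS exL] := super_edge_excess LS.
have good (P : pred (vertex L * vertex L)) :
  \sum_(e : vertex L * vertex L |
      [&& edge L e.1 e.2, label L e.2 \subset S & P e]) flow L y e.1 e.2
  = \sum_(e : vertex L * vertex L | edge L e.1 e.2 && P e) flow L y e.1 e.2.
  rewrite [RHS](bigID (fun e => label L e.2 \subset S)) /= [X in _ + X]big1.
    by rewrite addr0; apply: eq_bigl => e; rewrite -andbA; congr (_ && _); rewrite andbC.
  move=> e /andP[/andP[uv _] vS]; exact: super_edge_flow0 LS yY uv vS.
have := sum_excess (flow L y) (fun v => B :|: label L v == V).
rewrite /= !good (eq_bigr (fun v => (v == t)%:R)) => [|v _]; last exact: exL.
rewrite (sum_pred1 _ (fun v => B :|: label L v == V)) tS.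
have [LG _] := LS; rewrite (xlg_label_root LG) setU0 => ->.
by ring.
Qed.

(** * Gluing super edges into one graph *)

(** Each [e] contributes a copy of [load (ld e)] with labels enlarged by [base e], weights scaled by
    [a e] and flow by [q y e]. For excess, the copy counts as one edge from [base e] to
    [base e :|: ld e], which is what [ex] records; its [compl1] is scaled by [q y e ^+ 2 / a e]. *)
Lemma glue_super_edges (R : realType) (N : nat) (Z Y : {set point N})
    (E : finType) (base ld : E -> {set 'I_N}) (load : {set 'I_N} -> xlgraph R N)
    (a : E -> R) (q : point N -> E -> R)
    (ex := fun y (U : {set 'I_N}) => (U == set0)%:R
             + \sum_(e | base e :|: ld e == U) q y e
             - \sum_(e | base e == U) q y e) :
  (forall S, super_edge Z Y S (load S)) ->
  (forall S y, y \in Y -> compl1 (load S) y <= 1) ->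
  (forall e, [disjoint base e & ld e]) ->
  (forall e, 0 <= a e) ->
  (forall y e, y \in Y -> 0 <= q y e) ->
  (forall y e, y \in Y -> a e = 0 -> q y e = 0) ->
  (forall y U, y \in Y -> 0 <= ex y U) ->
  exists G : xlgraph R N,
    [/\ is_xlgraph Z Y G,
        forall y v, y \in Y -> is_sink (flow G y) v -> 0 < ex y (label G v),
        forall x, x \in Z -> compl0 G x <= \sum_e a e * compl0 (load (ld e)) x
      & forall y, y \in Y -> compl1 G y <= \sum_e q y e ^+ 2 / a e].
Proof.
move=> loadP load1 dis a0 q0 aq ex0.
pose VV e : finType := (vertex (load (ld e)) * vertex (load (ld e)))%type.
pose T : finType := {e : E & VV e}.
(* Inside [ld e], disjointness ensures that a loaded position is new to [base e] as well. *)
pose ok e (c : VV e) :=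
  edge (load (ld e)) c.1 c.2 && (label (load (ld e)) c.2 \subset ld e).
pose D (t : T) := ok _ (tagged t).
pose src e (c : VV e) := base e :|: label (load (ld e)) c.1.
pose dst e (c : VV e) := base e :|: label (load (ld e)) c.2.
pose s (t : T) := src _ (tagged t).
pose d (t : T) := dst _ (tagged t).
pose wt (b : bool) (z : point N) (t : T) :=
  a (tag t) * weight (load (ld (tag t))) b z (tagged t).1 (tagged t).2.
pose p (y : point N) (t : T) :=
  q y (tag t) * flow (load (ld (tag t))) y (tagged t).1 (tagged t).2.
have loadG S := proj1 (loadP S).
have YZ : Y \subset Z := xlg_subset (loadG set0).
have step t : D t -> exists j, [/\ j \notin s t, d t = s t :|: [set j] &
    label (load (ld (tag t))) (tagged t).2
    = label (load (ld (tag t))) (tagged t).1 :|: [set j]].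
  case: t => e [u v]; rewrite /D /ok /s /d /src /dst /= => /andP[uv vS].
  have [j ju vE] := xlg_label_edge (loadG _) uv.
  exists j; split => //; last by rewrite vE setUA.
  rewrite inE negb_or ju andbT.
  apply/negP => jB; have := disjointFr (dis e) jB.
  by rewrite (subsetP vS) // vE !inE eqxx orbT.
have Dsd t : D t -> hcube_edge (s t) (d t).
  by move=> /step[j [js dt _]]; apply/hcube_edgeP; exists j.
have w0 b z t : z \in Z -> D t -> 0 <= wt b z t.
  move=> zZ /andP[uv _]; rewrite mulr_ge0 //.
  exact: (xlg_weight_ge0 (loadG _)).
have wp y t : y \in Y -> D t -> wt true y t = 0 -> p y t = 0.
  move=> yY /andP[uv _] /eqP; rewrite mulf_eq0 => /orP[/eqP ae|/eqP we].
    by rewrite /p aq ?mul0r.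
  by rewrite /p (xlg_flow_weight (loadG _) yY uv we) mulr0.
have exE y U : y \in Y -> excess (flow (collapse D s d wt p) y) U = ex y U.
  move=> yY; rewrite collapse_excess // /ex -!addrA; congr (_ + _).
  have tagE (P : forall e, pred (VV e)) :
    \sum_(t | D t && P _ (tagged t)) p y t
    = \sum_e q y e * \sum_(c : VV e |
        [&& edge (load (ld e)) c.1 c.2,
            label (load (ld e)) c.2 \subset ld e & P e c])
        flow (load (ld e)) y c.1 c.2.
    under [RHS]eq_bigr do rewrite mulr_sumr.
    rewrite (@sig_big_dep _ _ _ E VV predT
      (fun e c => [&& edge (load (ld e)) c.1 c.2,
            label (load (ld e)) c.2 \subset ld e & P e c])
      (fun e c => q y e * flow (load (ld e)) y c.1 c.2)) /=.
    by apply: eq_bigl => t; rewrite /D /ok andbA.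
  rewrite (tagE (fun e c => dst e c == U)) (tagE (fun e c => src e c == U)).
  rewrite -sumrB /=.
  under eq_bigr => e _ do
    rewrite -mulrBr (super_edge_transport (base e) U (loadP (ld e)) yY) mulrBr.
  by rewrite sumrB; congr (_ - _); rewrite [RHS]big_mkcond /=;
    apply: eq_bigr => e _; case: ifP; rewrite ?mulr1 ?mulr0.
exists (collapse D s d wt p); split.
- apply: collapse_xlgraph => //.
  + move=> b z z' t zZ z'Z /andP[uv _] zz'; congr (_ * _).
    apply: (xlg_weight_restr (loadG _)) => //.
    by apply: restr_subset zz'; rewrite subsetUr.
  + move=> x y t j xZ yY Dt dt xy xyj.
    (* The position named by the merged labels must be the one that the piece itself loads. *)
    have [i [iNs dti lab]] := step t Dt; have /andP[uv _] := Dt.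
    have ij : i = j.
      have : i \in d t by rewrite dti !inE eqxx orbT.
      by rewrite dt in_setU in_set1 (negbTE iNs) => /eqP.
    congr (_ * _); apply: (xlg_weight01 (loadG _)) xyj => //.
      by rewrite -ij.
    by apply: restr_subset xy; rewrite subsetUr.
  + move=> y t yY /andP[uv _]; rewrite mulr_ge0 ?q0 //.
    by have [+ _] := xlg_unit_flow (loadG (ld (tag t))) yY; apply.
  + by move=> y V yY; rewrite exE // ex0.
- by move=> y v yY; rewrite /is_sink exE.
- move=> x xZ; rewrite collapse_compl0 //.
  rewrite -(@sig_big_dep _ _ _ E VV predT ok (fun e c =>
     a e * weight (load (ld e)) false x c.1 c.2)) /=.
  apply: ler_sum => e _; rewrite -mulr_sumr ler_wpM2l // /compl0.
  (* The discarded edges have nonnegative weight, so dropping them only lowers the sum. *)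
  rewrite [leRHS](bigID (fun c => label (load (ld e)) c.2 \subset ld e)) /=.
  rewrite lerDl; apply: sumr_ge0 => c /andP[uv _].
  exact: (xlg_weight_ge0 (loadG _)).
- move=> y yY; have yZ := subsetP YZ _ yY.
  apply: le_trans (collapse_compl1 Dsd _ _) _; [by auto..|].
  rewrite -(@sig_big_dep _ _ _ E VV predT ok (fun e c =>
     (q y e * flow (load (ld e)) y c.1 c.2) ^+ 2
     / (a e * weight (load (ld e)) true y c.1 c.2))) /=.
  apply: ler_sum => e _.
  under eq_bigr do rewrite exprMn invfM mulrACA.
  rewrite -mulr_sumr ler_piMr ?divr_ge0 ?sqr_ge0 //.
  apply: le_trans (load1 (ld e) y yY); rewrite /compl1.
  rewrite [leRHS](bigID (fun c => label (load (ld e)) c.2 \subset ld e)) /=.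
  rewrite lerDl; apply: sumr_ge0 => c /andP[uv _].
  by rewrite divr_ge0 ?sqr_ge0 //; apply: (xlg_weight_ge0 (loadG _)).
Qed.

Lemma sum_expectation (R : realType) (T : finType) (D : {set T}) (F : T -> R) :
  \sum_(t in D) F t = expectation D F * #|D|%:R.
Proof.
have [D0|D0] := eqVneq #|D| 0%N; last by rewrite divfK // pnatr_eq0.
by rewrite D0 mulr0; move/eqP: D0; rewrite cards_eq0 => /eqP ->; rewrite big_set0.
Qed.

(** * Chains of subsets and the flow along them *)

(** The missing elements of [T] are added in enumeration order; beyond [#|T :\: A|] steps the chain
    stays at [A :|: T]. *)
Definition chain (n : nat) (T A : {set 'I_n}) (s : nat) : {set 'I_n} :=
  A :|: [set x in take s (enum (T :\: A))].

Lemma chain0 (n : nat) (T A : {set 'I_n}) : chain T A 0 = A.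
Proof.
by rewrite /chain take0; apply/setP => x; rewrite !inE orbF.
Qed.

Lemma chain_full (n : nat) (T A : {set 'I_n}) :
  chain T A #|T :\: A| = A :|: T.
Proof.
rewrite /chain cardE take_size; apply/setP => x.
by rewrite !inE mem_enum !inE; case: (x \in A).
Qed.

Lemma chain_sub (n : nat) (T A : {set 'I_n}) (s : nat) :
  chain T A s :\: A \subset T.
Proof.
apply/subsetP => x; rewrite !inE => /andP[/negbTE -> /= /mem_take].
by rewrite mem_enum inE => /andP[].
Qed.

Lemma chainS (n : nat) (T A : {set 'I_n}) (s : nat) : (s < #|T :\: A|)%N ->
  exists2 j, j \notin chain T A s & chain T A s.+1 = j |: chain T A s.
Proof.
rewrite cardE => sT; case sE: (enum _) sT => [//|x0 c]; rewrite -sE => sT.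
exists (nth x0 (enum (T :\: A)) s); last first.
  apply/setP => x; rewrite !inE (take_nth x0) // mem_rcons inE.
  by case: (x \in A); rewrite ?orbT.
have := mem_nth x0 sT; rewrite mem_enum inE => /andP[/negbTE jA _].
rewrite !inE jA /=; apply/negP => /nthP -/(_ x0)[i].
rewrite size_takel ?(ltnW sT) // => si; rewrite nth_take // => /eqP.
by rewrite nth_uniq ?enum_uniq ?(ltn_trans si) // ltn_eqF.
Qed.

Lemma card_chain (n : nat) (T A : {set 'I_n}) (s : nat) :
  (s <= #|T :\: A|)%N -> #|chain T A s| = (#|A| + s)%N.
Proof.
elim: s => [|s IHs] sT; first by rewrite chain0 addn0.
by have [j jc ->] := chainS sT; rewrite cardsU1 jc IHs 1?ltnW // addnS.
Qed.

(* [inl A] stands for loading I(A) from scratch, and [inr (A', A'')] for the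
   transition from A' to A''. *)
Definition johnson_piece (n : nat) : finType :=
  ({set 'I_n} + {set 'I_n} * {set 'I_n})%type.

(* One unit of flow is spread uniformly over the l-subsets A, and the share of
   A then follows the chain from A to the union of A and T. *)
Definition johnson_flow (R : realType) (n l : nat) (T : {set 'I_n})
    (e : johnson_piece n) : R :=
  (#|ksubsets n l|%:R)^-1 * \sum_(A in ksubsets n l)
    ((e == inl A)%:R
     + \sum_(s < #|T :\: A|) (e == inr (chain T A s, chain T A s.+1))%:R).

Lemma sum_johnson_flow (R : realType) (n l : nat) (T : {set 'I_n})
    (Q : pred (johnson_piece n)) :
  \sum_(e | Q e) johnson_flow R l T e =
  (#|ksubsets n l|%:R)^-1 * \sum_(A in ksubsets n l)
    ((Q (inl A))%:R
     + \sum_(s < #|T :\: A|) (Q (inr (chain T A s, chain T A s.+1)))%:R).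
Proof.
rewrite -mulr_sumr exchange_big /=; congr (_ * _); apply: eq_bigr => A _.
rewrite big_split /= sum_pred1; congr (_ + _).
by rewrite exchange_big /=; apply: eq_bigr => s _; rewrite sum_pred1.
Qed.

Lemma johnson_flow_ge0 (R : realType) (n l : nat) (T : {set 'I_n}) e :
  0 <= johnson_flow R l T e.
Proof.
by rewrite mulr_ge0 ?invr_ge0 //; apply: sumr_ge0 => A _; rewrite addr_ge0 //;
  apply: sumr_ge0.
Qed.

(** The chain of [A] takes the transition [P] at most once, and then [A] is [P.1] minus the part of
    [T] added so far. *)
Lemma chain_step_count (R : realType) (n : nat) (T A : {set 'I_n}) P :
  \sum_(s < #|T :\: A|) (P == (chain T A s, chain T A s.+1))%:R
    <= (A \in [set P.1 :\: D | D in powerset T])%:R :> R.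
Proof.
case: P => P1 P2; rewrite /=.
have [AP|AP] := boolP (A \in _); last first.
  rewrite big1 // => s _; case: eqP => // -[P1E _]; case/imsetP: AP.
  exists (P1 :\: A); first by rewrite inE P1E chain_sub.
  by rewrite setDDr setDv set0U P1E; apply/esym/setIidPr; rewrite subsetUl.
(* The cardinality of [P.1] forces the time [s] of the transition. *)
apply: (@le_trans _ _ (\sum_(s < #|T :\: A|) (val s == #|P1| - #|A|)%N%:R)).
  apply: ler_sum => s _; rewrite ler_nat; case: eqP => // -[-> _].
  by rewrite card_chain ?(ltnW (ltn_ord _)) // addKn eqxx.
have [lt|ge] := ltnP (#|P1| - #|A|)%N #|T :\: A|.
  by rewrite (sum_pred1 R predT (Ordinal lt)).
rewrite big1 // => s _; case: eqP => // sE.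
by have := ltn_ord s; rewrite sE ltnNge ge.
Qed.

(** A transition is shared by at most one [A] for each subset of [T], a fresh load by at most one in
    all. *)
Lemma johnson_flow_le (R : realType) (n l : nat) (T : {set 'I_n}) e :
  johnson_flow R l T e <= (2 ^ #|T|)%:R / #|ksubsets n l|%:R.
Proof.
rewrite [leLHS]mulrC ler_wpM2r ?invr_ge0 //; case: e => [B | P].
  apply: (@le_trans _ _ 1); last by rewrite ler1n expn_gt0.
  under eq_bigr do rewrite [X in _ + X]big1 // addr0.
  have -> : \sum_(A in ksubsets n l) ((inl B : johnson_piece n) == inl A)%:R
     = \sum_(A in ksubsets n l) (A == B)%:R :> R.
    by apply: eq_bigr => A _; rewrite eq_sym.
  by rewrite sum_pred1; case: (_ \in _).
apply: (@le_trans _ _ (\sum_(A in ksubsets n l)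
  (A \in [set P.1 :\: D | D in powerset T])%:R)).
  by apply: ler_sum => A _; rewrite add0r; apply: chain_step_count.
rewrite -natr_sum ler_nat -big_mkcondr sum1_card -card_powerset.
apply: leq_trans (leq_imset_card (fun D => P.1 :\: D) _).
by apply: subset_leq_card; apply/subsetP => A; rewrite unfold_in => /andP[].
Qed.

(** These are the pieces that a chain can meet when [T] has [r] elements; only they will get a
    nonzero coefficient and so count in [compl0]. *)
Definition johnson_used (n l r : nat) (e : johnson_piece n) : bool :=
  match e with
  | inl A => A \in ksubsets n l
  | inr P => [exists s : 'I_r, P \in kpairs n (l + s)]
  end.

Lemma johnson_flow_used (R : realType) (n l : nat) (T : {set 'I_n}) e :
  ~~ johnson_used l #|T| e -> johnson_flow R l T e = 0.
Proof.
move=> ne; rewrite /johnson_flow big1 ?mulr0 // => A AK.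
case: e ne => [B | P] /= ne.
  rewrite big1 // addr0; case: eqP => // -[BA].
  by rewrite BA AK in ne.
rewrite add0r big1 // => s _; case: eqP => // -[PE]; case/existsP: ne.
have sT : (s < #|T|)%N.
  by apply: leq_trans (ltn_ord s) _; rewrite subset_leq_card ?subsetDl.
exists (Ordinal sT); rewrite PE inE /=; move: AK; rewrite inE => /eqP Al.
rewrite !card_chain ?(ltnW (ltn_ord s)) // Al addnS !eqxx.
by have [j _ ->] := chainS (ltn_ord s); rewrite subsetUr.
Qed.

(** * Counting transitions *)

Lemma card_kpairs (n i : nat) : (#|kpairs n i| <= 'C(n, i) * n)%N.
Proof.
pose g (c : {set 'I_n} * 'I_n) := (c.1, c.2 |: c.1).
apply: (@leq_trans #|g @: setX (ksubsets n i) setT|); last first.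
  apply: leq_trans (leq_imset_card _ _) _.
  rewrite cardsX cardsT card_ord leq_mul2r.
  by rewrite -[n in 'C(n, _)]card_ord -card_draws leqnn orbT.
apply/subset_leq_card/subsetP => -[P1 P2].
rewrite inE /= => /and3P[P12 /eqP c1 /eqP c2].
have /cards1P[j jE] : #|P2 :\: P1| == 1%N.
  by rewrite cardsD (setIidPr P12) c1 c2 subSnn.
apply/imsetP; exists (P1, j); first by rewrite !inE c1 eqxx.
by rewrite /g /= -jE -{1}(setID P2 P1) (setIidPr P12) setUC.
Qed.

(** Consecutive binomials have ratio $(n-i)/(i+1)$, at most $nr/k$ because $k \le (i+1)r$ once $i
    \ge k-r$. *)
Lemma bin_ratio (n k r s : nat) : (0 < r)%N -> (r <= k)%N ->
  ('C(n, k - r + s) * k ^ s <= 'C(n, k - r) * (n * r) ^ s)%N.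
Proof.
move=> r0 rk; elim: s => [|s IHs]; first by rewrite addn0 !expn0.
set i := (k - r + s)%N in IHs *.
have -> : (k - r + s.+1 = i.+1)%N by rewrite addnS.
have ki : (k <= i.+1 * r)%N.
  rewrite mulSn -leq_subLR (leq_trans (leq_addr s _)) // -/i.
  by rewrite leq_pmulr.
have step : ('C(n, i.+1) * k <= 'C(n, i) * (n * r))%N.
  apply: (@leq_trans ('C(n, i.+1) * (i.+1 * r))).
    by rewrite leq_mul2l ki orbT.
  rewrite mulnA [('C(n, i.+1) * _)%N]mulnC mul_bin_left mulnA leq_mul2r.
  by rewrite mulnC leq_mul2l leq_subr !orbT.
rewrite !expnS mulnA (leq_trans (_ : _ <= 'C(n, i) * (n * r) * k ^ s))%N //.
  by rewrite leq_mul2r step orbT.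
by rewrite -mulnA mulnCA [X in (_ <= X)%N]mulnCA leq_mul2l IHs orbT.
Qed.

Lemma card_kpairs_le (R : realType) (n k r s : nat) :
  (r <= k)%N -> (k <= n)%N -> (s < r)%N ->
  #|kpairs n (k - r + s)|%:R <=
    #|ksubsets n (k - r)|%:R * (r ^ r)%:R * (k%:R * (n%:R / k%:R) ^+ r) :> R.
Proof.
move=> rk kn sr; have r0 : (0 < r)%N := leq_ltn_trans (leq0n s) sr.
have k0 : 0 < k%:R :> R by rewrite ltr0n (leq_trans r0).
have -> : #|ksubsets n (k - r)| = 'C(n, k - r).
  by rewrite -[n in RHS]card_ord -card_draws.
pose M : R := 'C(n, k - r)%:R.
have M0 : 0 <= M by [].
have CM : 'C(n, k - r + s)%:R <= M * (n%:R / k%:R) ^+ s * (r ^ s)%:R.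
  rewrite expr_div_n mulrA mulrAC ler_pdivlMr ?exprn_gt0 //.
  rewrite -mulrA -!natrX -!natrM ler_nat -expnMn.
  exact: bin_ratio.
have nk : 1 <= n%:R / k%:R :> R by rewrite ler_pdivlMr // mul1r ler_nat.
apply: le_trans (_ : 'C(n, k - r + s)%:R * n%:R <= _).
  by rewrite -natrM ler_nat card_kpairs.
apply: (@le_trans _ _ (M * (n%:R / k%:R) ^+ s * (r ^ s)%:R * n%:R)).
  by rewrite ler_wpM2r.
(* Writing $n = k(n/k)$ raises the exponent to $s+1$, which is still at most $r$; the base is at
   least 1. *)
have -> : M * (n%:R / k%:R) ^+ s * (r ^ s)%:R * n%:R
   = M * (r ^ s)%:R * (k%:R * (n%:R / k%:R) ^+ s.+1).
  by rewrite exprS; field; rewrite gt_eqF.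
have nk0 := le_trans ler01 nk.
apply: ler_pM; rewrite ?mulr_ge0 ?exprn_ge0 //.
  by apply: ler_wpM2l => //; rewrite ler_nat leq_pexp2l // ltnW.
by rewrite ler_pM2l // ler_weXn2l.
Qed.

(** * Assembling the Johnson graph *)

Definition piece_base (N n : nat) (I : {set 'I_n} -> {set 'I_N})
    (e : johnson_piece n) : {set 'I_N} :=
  match e with inl _ => set0 | inr P => I P.1 end.

Definition piece_load (N n : nat) (I : {set 'I_n} -> {set 'I_N})
    (e : johnson_piece n) : {set 'I_N} :=
  match e with inl A => I A | inr P => I P.2 :\: I P.1 end.

(** For each [A], the fresh load moves its share from the empty set to [I A], and the transitions
    telescope from there to [I (A :|: T)]. *)
Lemma johnson_transport (R : realType) (N n l : nat)
    (I : {set 'I_n} -> {set 'I_N}) (T : {set 'I_n}) (U : {set 'I_N}) :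
  (forall A' A'' : {set 'I_n}, A' \subset A'' -> I A' \subset I A'') ->
  (l <= n)%N ->
  (U == set0)%:R
  + \sum_(e | piece_base I e :|: piece_load I e == U) johnson_flow R l T e
  - \sum_(e | piece_base I e == U) johnson_flow R l T e
  = (#|ksubsets n l|%:R)^-1
      * \sum_(A in ksubsets n l) (I (A :|: T) == U)%:R.
Proof.
move=> Imono ln.
have M0 : #|ksubsets n l|%:R != 0 :> R.
  by rewrite pnatr_eq0 card_draws card_ord -lt0n bin_gt0.
rewrite (sum_johnson_flow R l T (fun e => _ == U)).
rewrite (sum_johnson_flow R l T (fun e => piece_base I e == U)) /=.
(* The unit injected at the root is written as an average over [A], so that the identity can be
   checked for each [A] separately. *)
have -> : (U == set0)%:R = (#|ksubsets n l|%:R)^-1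
    * \sum_(A in ksubsets n l) (set0 == U)%:R :> R.
  by rewrite sumr_const -[X in _ * X]mulr_natl mulrA mulVf // mul1r eq_sym.
rewrite -mulrDr -mulrBr -big_split -sumrB /=; congr (_ * _).
apply: eq_bigr => A _; rewrite set0U.
set f := fun s => (I (chain T A s) == U)%:R : R.
have tele := telescope_sumr f (leq0n #|T :\: A|).
rewrite {3 4}/f chain_full chain0 big_mkord in tele.
rewrite (eq_bigr (fun s : 'I__ => f s.+1)); last first.
  move=> s _; have sub : I (chain T A s) \subset I (chain T A s.+1).
    by have [j _ ->] := chainS (ltn_ord s); apply/Imono/subsetUr.
  congr ((_ == _)%:R).
  by rewrite -[RHS](setID _ (I (chain T A s))) (setIidPr sub).
move: tele; rewrite sumrB => tele.
rewrite -[RHS](subrK (I A == U)%:R) -tele /f; ring.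
Qed.

Theorem theorem4p2 (R : realType) (r : nat) (r_gt0 : (0 < r)%N) :
  exists2 K : R, 0 < K &
  forall (N n k : nat) (Z : {set point N})
    (fA : {set 'I_n} -> point N -> bool) (f : point N -> bool)
    (load : {set 'I_N} -> xlgraph R N)
    (I : {set 'I_n} -> {set 'I_N})
    (G : forall A : {set 'I_n}, assignment (I A) -> xlgraph R N)
    (bS bU bC : R),
  (r <= k)%N -> (k <= n)%N ->
  (forall z, z \in Z -> f z = [exists A in ksubsets n k, fA A z]) ->
  (forall S, super_edge Z (positives Z f) S (load S)) ->
  (forall S, max_compl1 (positives Z f) (load S) <= 1) ->
  (forall A' A'' : {set 'I_n}, A' \subset A'' -> I A' \subset I A'') ->
  (forall y, y \in positives Z f ->
     exists2 T : {set 'I_n}, #|T| = r & certificate1 Z f y (I T)) ->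
  0 < bS -> 0 < bU -> 0 < bC ->
  (forall x, x \in Z -> f x = false ->
     expectation (ksubsets n (k - r)) (fun A' => compl0 (load (I A')) x)
       <= bS ^+ 2) ->
  (forall x i, x \in Z -> f x = false -> (k - r <= i < k)%N ->
     expectation (kpairs n i)
       (fun P => compl0 (load (I P.2 :\: I P.1)) x) <= bU ^+ 2) ->
  (forall (A : {set 'I_n}) (lam : assignment (I A)), #|A| = k ->
     xlgraph_for (fiber Z lam) (fA A) (G A lam)) ->
  (forall x, x \in Z -> f x = false ->
     expectation (ksubsets n k)
       (fun A => let lam := restr (I A) x in
          compl0 (G A lam) x
          * max_compl1 (positives (fiber Z lam) (fA A)) (G A lam))
       <= bC ^+ 2) ->
  exists GJ : xlgraph R N,
    [/\ xlgraph_for Z f GJ,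
        forall z, z \in Z -> f z = false ->
          compl0 GJ z <=
            K * (bS ^+ 2 + (n%:R / k%:R) ^+ r * (k%:R * bU ^+ 2 + bC ^+ 2))
      & forall z, z \in Z -> f z = true -> compl1 GJ z <= 1].
Proof.
(* In [c], the factor [2 ^ r] bounds the flow through a piece and [r.+1] the total flow. In [rr],
   there are [r] layers, each costing [r ^ r]. *)
pose rr : R := (r * r ^ r)%:R; pose c : R := r.+1%:R * (2 ^ r)%:R.
have rr1 : 1 <= rr by rewrite ler1n muln_gt0 r_gt0 expn_gt0 r_gt0.
have c0 : 0 < c by rewrite mulr_gt0 // ltr0n expn_gt0.
exists (c * rr); first by rewrite mulr_gt0 // (lt_le_trans ltr01).
move=> N n k Z fA f load I G bS bU bC rk kn _ loadP load1 Imono cert.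
move=> _ _ _ boundS boundU _ _.
set l := (k - r)%N; pose M : R := #|ksubsets n l|%:R.
have ln : (l <= n)%N by rewrite (leq_trans (leq_subr _ _)).
have M0 : 0 < M by rewrite ltr0n card_draws card_ord bin_gt0.
have cM0 : 0 < c / M by rewrite divr_gt0.
have [T TP] : exists T : point N -> {set 'I_n}, forall y,
    y \in positives Z f -> #|T y| = r /\ certificate1 Z f y (I (T y)).
  apply: (@fin_all_exists _ (fun=> {set 'I_n}) (fun y T =>
    y \in positives Z f -> #|T| = r /\ certificate1 Z f y (I T))) => y.
  have [/cert[T Tr Tc]|_] := boolP (y \in _).
    by exists T.
  by exists set0.
pose a (e : johnson_piece n) : R := c / M * (johnson_used l r e)%:R.
have a0 e : 0 <= a e by rewrite mulr_ge0 // ltW.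
have aq y e : y \in positives Z f -> a e = 0 -> johnson_flow R l (T y) e = 0.
  move=> /TP[Tr _] /eqP; rewrite mulf_eq0 (gt_eqF cM0) pnatr_eq0 eqb0 /=.
  by rewrite -Tr; apply: johnson_flow_used.
have q0 y (e : johnson_piece n) : y \in positives Z f ->
    0 <= johnson_flow R l (T y) e by move=> _; apply: johnson_flow_ge0.
have load1' S y : y \in positives Z f -> compl1 (load S) y <= 1.
  move=> yY; apply: le_trans (load1 S).
  by rewrite /max_compl1 (bigmaxD1 y) // le_max lexx.
have dis e : [disjoint piece_base I e & piece_load I e].
  by case: e => [A | P] /=; rewrite -setI_eq0 ?set0I // setDE setICA setICr setI0.
have transport y U := @johnson_transport R N n l I (T y) U Imono ln.
have [|GJ [GJP GJsink GJ0 GJ1]] := glue_super_edges loadP load1' dis a0 q0 aq.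
  move=> y U _; rewrite transport mulr_ge0 ?invr_ge0 ?(ltW M0) //.
  exact: sumr_ge0.
exists GJ; split; first split=> // y v yY.
(* A positive average has a nonzero term, so a sink is labelled [I (A :|: T y)], which contains the
   certificate by monotonicity. *)
- move=> /(GJsink y v yY); rewrite transport pmulr_rgt0 ?invr_gt0 // => sum0.
  have [A AK AU] : exists2 A, A \in ksubsets n l & I (A :|: T y) == label GJ v.
    apply/exists_inP; apply: contraLR sum0 => /exists_inPn noA.
    by rewrite big1 ?ltxx // => A /noA /negbTE ->.
  exists (I (T y)); last by have [_] := TP y yY.
  by rewrite -(eqP AU); apply/Imono/subsetUr.
- move=> x xZ fx; apply: le_trans (GJ0 x xZ) _.
  rewrite big_sumType /=.
  set e := (n%:R / k%:R) ^+ r.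
  have e0 : 0 <= e by rewrite exprn_ge0 // divr_ge0.
  have c_ge0 S : 0 <= compl0 (load S) x.
    by apply: sumr_ge0 => p ?; apply: (xlg_weight_ge0 (proj1 (loadP S))).
  have fresh : \sum_(A : {set 'I_n}) a (inl A) * compl0 (load (I A)) x
      <= c * bS ^+ 2.
    rewrite (eq_bigr (fun A => c / M * ((A \in ksubsets n l)%:R
       * compl0 (load (I A)) x))) => [|A _]; last by rewrite mulrA.
    rewrite -mulr_sumr (eq_bigr (fun A => if A \in ksubsets n l then
       compl0 (load (I A)) x else 0)) => [|A _]; last by rewrite mulr_natl mulrb.
    rewrite -big_mkcond (sum_expectation _ (fun A => compl0 (load (I A)) x)).
    rewrite mulrCA -/M divfK ?gt_eqF // mulrC ler_pM2l //.
    exact: boundS.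
  have step : \sum_(P : {set 'I_n} * {set 'I_n})
        a (inr P) * compl0 (load (I P.2 :\: I P.1)) x
      <= c * (rr * e * k%:R * bU ^+ 2).
    (* The used transitions are covered by the [r] layers, and all terms are nonnegative. *)
    apply: (@le_trans _ _ (c / M * \sum_(s < r) \sum_(P in kpairs n (l + s))
        compl0 (load (I P.2 :\: I P.1)) x)).
      rewrite (exchange_big_dep predT) //= mulr_sumr; apply: ler_sum => P _.
      rewrite /a /= -mulrA ler_pM2l // mulr_natl mulrb; case: existsP => [[s Ps]|_].
        by rewrite (bigD1 s) //= lerDl sumr_ge0.
      by apply: sumr_ge0.
    rewrite -mulrA ler_pM2l // mulrC ler_pdivrMr //.
    apply: (@le_trans _ _ (\sum_(s < r)
        M * (r ^ r)%:R * (k%:R * e) * bU ^+ 2)); last first.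
      rewrite sumr_const card_ord -[leLHS]mulr_natl /rr natrM le_eqVlt.
      by apply/orP; left; apply/eqP; ring.
    apply: ler_sum => s _.
    rewrite (sum_expectation _ (fun P => compl0 (load (I P.2 :\: I P.1)) x)).
    rewrite mulrC; apply: ler_pM => //; last 2 first.
    - exact: card_kpairs_le.
    - apply: boundU => //; rewrite leq_addr /= /l -ltn_subRL.
      by rewrite subKn.
    by rewrite divr_ge0 // sumr_ge0.
  apply: le_trans (lerD fresh step) _.
  rewrite -mulrDr -[leRHS]mulrA ler_pM2l //.
  (* Since [rr] is at least 1, the constant [c * rr] also covers the setup term. *)
  have bS1 : bS ^+ 2 <= rr * bS ^+ 2 by rewrite ler_peMl ?sqr_ge0.
  have : 0 <= rr * e * bC ^+ 2.
    by apply: mulr_ge0 (sqr_ge0 _); apply: mulr_ge0.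
  rewrite !mulrDr !mulrA; lra.
- move=> y yZ fy; have yY : y \in positives Z f by rewrite inE yZ fy.
  have [Tr _] := TP y yY; apply: le_trans (GJ1 y yY) _.
  (* One factor of the squared flow is at most [2 ^ r / M]; divided by [a e] it leaves
     [1 / r.+1]. *)
  apply: (@le_trans _ _ (\sum_e johnson_flow R l (T y) e / r.+1%:R)).
    apply: ler_sum => e _; have [->|ne] := eqVneq (johnson_flow R l (T y) e) 0.
      by rewrite expr0n !mul0r.
    have used : johnson_used l r e.
      by apply: contraNT ne; rewrite -Tr => /johnson_flow_used ->.
    rewrite expr2 -mulrA ler_wpM2l ?johnson_flow_ge0 // /a used mulr1.
    rewrite ler_pdivrMr // /c -mulrA mulKf ?pnatr_eq0 //.
    by rewrite -Tr johnson_flow_le.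
  rewrite -mulr_suml ler_pdivrMr ?ltr0n // mul1r.
  (* Each [A] passes its share through one load and [#|T y :\: A|] transitions, at most [r.+1]
     pieces. *)
  rewrite (sum_johnson_flow R l (T y) predT) ler_pdivrMl //.
  rewrite /M mulr_natl -sumr_const; apply: ler_sum => A _ /=.
  rewrite sumr_const card_ord -mulr_natr mul1r -natrD ler_nat add1n ltnS -Tr.
  by rewrite subset_leq_card ?subsetDl.
Qed.
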